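(* For every integer $k \ge 1$ and every integer $d \ge 2$, there exists a $k$-SI graph $G$ with $\operatorname{diam}(G) = d$.
   Context: Graphs are finite and simple. For a positive integer $k$, a graph $G$ is a $k$-stepwise irregular graph ($k$-SI graph) if $|d_G(u) - d_G(v)| = k$ for every edge $uv \in E(G)$, where $d_G(x)$ is the degree of $x$ in $G$. The diameter $\operatorname{diam}(G)$ is the maximum distance between two vertices of $G$; saying that $G$ has diameter $d$ (a finite number) includes that $G$ is connected. *)

(* Defs.v *)
From mathcomp Require Import all_boot all_order all_algebra.

Set Implicit Arguments.
Unset Strict Implicit.
Unset Printing Implicit Defensive.

Record sgraph := SGraph {
  vertex :> finType;
  edge : rel vertex;
  edge_sym : symmetric edge;
  edge_irrefl : irreflexive edge
}.

Definition deg (G : sgraph) (u : G) : nat := #|[set v | edge u v]|.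

(* The difference is taken in int, since subtraction on nat is truncated. *)
Definition stepwise_irregular (k : nat) (G : sgraph) : Prop :=
  forall u v : G, edge u v ->
    (`|(deg u)%:Z - (deg v)%:Z| = k%:Z :> int)%R.

(* [u :: p] lists the vertices of a u-v path in the graph-theoretic sense
   (no repeated vertex); its length is [size p]. *)
Definition is_path (G : sgraph) (u v : G) (p : seq G) : bool :=
  [&& path (@edge G) u p, last u p == v & uniq (u :: p)].

(* Distance as a relation, so that it is undefined between vertices lying in
   different components. *)
Definition is_dist (G : sgraph) (u v : G) (n : nat) : Prop :=
  (exists2 p : seq G, is_path u v p & size p = n) /\
  (forall p : seq G, is_path u v p -> n <= size p).

Definition connected (G : sgraph) : Prop :=
  forall u v : G, connect (@edge G) u v.

Definition has_diameter (G : sgraph) (d : nat) : Prop :=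
  [/\ connected G,
      exists u v : G, is_dist u v d
    & forall (u v : G) (n : nat), is_dist u v n -> n <= d].

(* Main.v *)
(** Replacing each vertex [x] of a graph by [k * w x] pairwise non-adjacent copies
    keeps the diameter when it is at least 2, and multiplies by [k] the weighted degree
    [D x = \sum_(y ~ x) w y].  So it is enough to find a graph of diameter [d] and positive
    weights such that [D] changes by exactly 1 along each edge.
    For [d <> 3] the path [0 - 1 - ... - d] works:
    - [d] even: weights 1 2 2 2 1 2 2 2 1 ..., with [D] = 2 3 4 3 4 ... 4 3 2;
    - [d >= 5] odd: weights 2 3 2 2 2 1 2 2 2 1 ..., with [D] = 3 4 5 4 3 4 3 4 ... 4 3 2.
    No weights on the path work for [d = 3]; there one takes the 6-cycle
    [K_{3,3}] minus a perfect matching, plus a vertex joined to one colour class. *)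
Require Import Defs.
From mathcomp Require Import all_boot all_order all_algebra.
From mathcomp Require Import zify.

Set Implicit Arguments.
Unset Strict Implicit.
Unset Printing Implicit Defensive.

(** * Diameter computed from walks instead of paths *)

Section Walks.
Variable G : sgraph.
Implicit Types (u v x : G) (p : seq G).

(** Walks may repeat vertices, so they can be extended, lifted and projected with no uniqueness to
    maintain. *)
Definition walk_le n u v : Prop :=
  exists p, [/\ path (@edge G) u p, last u p = v & size p <= n].

Definition far n u v : Prop :=
  forall p, path (@edge G) u p -> last u p = v -> n <= size p.

Lemma walk_le_refl n u : walk_le n u u.
Proof. by exists [::]. Qed.

Lemma walk_le_step n u x v : edge u x -> walk_le n x v -> walk_le n.+1 u v.
Proof. by move=> ux [p [xp pv sp]]; exists (x :: p); split; rewrite //= ux. Qed.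

Lemma walk_leW n u v : walk_le n u v -> walk_le n.+1 u v.
Proof. by case=> p [up pv sp]; exists p; split=> //; exact: leqW. Qed.

Lemma has_diameter_walks d u v :
  (forall x y : G, walk_le d x y) -> far d u v -> has_diameter G d.
Proof.
move=> reach fuv.
have short x y : exists2 p, is_path x y p & size p <= d.
  have [p [xp <- sp]] := reach x y.
  case/shortenP: xp => p' xp' uniq_p' sub_p'.
  exists p'; first by rewrite /is_path xp' eqxx.
  apply: leq_trans sp; apply: uniq_leq_size sub_p'.
  by case/andP: uniq_p'.
split.
- move=> x y; have [p /and3P[xp /eqP <- _] _] := short x y.
  by apply/connectP; exists p.
- exists u, v; split.
    have [p pp sp] := short u v; exists p => //.
    by case/and3P: pp => up /eqP pv _; apply/eqP; rewrite eqn_leq sp fuv.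
  by move=> p /and3P[up /eqP pv _]; exact: fuv.
- by move=> x y n [_ min_n]; have [p /min_n np /(leq_trans np)] := short x y.
Qed.

End Walks.

(** * Replacing vertices by independent sets of copies *)

Section BlowUp.
Variables (G : sgraph) (f : G -> nat).

Definition blowup_vertex : finType := {x : G & 'I_(f x)}.
Definition blowup_edge : rel blowup_vertex := fun u v => edge (tag u) (tag v).

Lemma blowup_edge_sym : symmetric blowup_edge.
Proof. by move=> u v; exact: edge_sym. Qed.

Lemma blowup_edge_irrefl : irreflexive blowup_edge.
Proof. by move=> u; exact: edge_irrefl. Qed.

Definition blowup := SGraph blowup_edge_sym blowup_edge_irrefl.

Lemma deg_blowup (u : blowup) : deg u = \sum_(y | edge (tag u) y) f y.
Proof.
rewrite /deg cardsE -sum1_card.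
under [RHS]eq_bigr => y _ do rewrite -[f y]card_ord -sum1_card.
rewrite sig_big_dep /=.
by apply: eq_bigl => v; rewrite unfold_in /= andbT.
Qed.

Hypothesis f_gt0 : forall x, 0 < f x.

Definition copy (x : G) : blowup := existT (fun y => 'I_(f y)) x (Ordinal (f_gt0 x)).

(** Both end copies are prescribed, so only the interior vertices are sent to their first copy. *)
Lemma lift_walk (p : seq G) (u v : blowup) :
    path (@edge G) (tag u) (rcons p (tag v)) ->
  exists q : seq blowup,
    [/\ path (@edge blowup) u q, last u q = v & size q = (size p).+1].
Proof.
elim: p u => [|y p IHp] u /=.
  by rewrite andbT => uv; exists [:: v]; split=> //=; rewrite andbT.
case/andP=> uy yp; have [q [cq qv sq]] := IHp (copy y) yp.
exists (copy y :: q); split; rewrite //= ?sq //.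
by rewrite cq andbT.
Qed.

Lemma far_blowup d (u v : blowup) : far d (tag u) (tag v) -> far d u v.
Proof.
move=> fuv p up pv; rewrite -(size_map tag); apply: fuv.
  by rewrite path_map.
by rewrite last_map pv.
Qed.

Lemma walk_le_blowup d (u v : blowup) :
    1 < d -> (exists y, edge (tag u) y) -> walk_le d (tag u) (tag v) ->
  walk_le d u v.
Proof.
move=> d_gt1 [y uy] [p]; case: (lastP p) => [|{}p x] [up /= pv sp].
  (* The empty walk means that [u] and [v] are copies of one vertex; a copy of a neighbour joins
     them in 2 steps, whence [1 < d]. *)
  exists [:: copy y; v]; split=> //=.
  by rewrite /blowup_edge /= uy -pv edge_sym uy.
rewrite last_rcons in pv; rewrite pv in up.
have [q [uq qv sq]] := lift_walk up.
by exists q; split=> //; rewrite sq -(size_rcons p x).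
Qed.

Lemma has_diameter_blowup d (a b : G) :
    1 < d -> (forall x y : G, walk_le d x y) -> far d a b ->
  has_diameter blowup d.
Proof.
move=> d_gt1 reach fab.
have ab : a != b.
  by apply/eqP=> ab; have := fab [::] isT ab; rewrite leqNgt (ltnW d_gt1).
have nbr (x : G) : exists y, edge x y.
  have [z xz] : exists z, x != z.
    by have [->|] := eqVneq x a; [exists b | exists a].
  have [[|y p] [/= xp pz _]] := reach x z.
    by rewrite pz eqxx in xz.
  by case/andP: xp; exists y.
apply: (@has_diameter_walks _ _ (copy a) (copy b)); last exact: far_blowup.
by move=> u v; exact: walk_le_blowup.
Qed.

End BlowUp.

Lemma weighted_si_diameter (G : sgraph) (w : G -> nat) (k d : nat) (a b : G) :
    let D x := \sum_(y | edge x y) w y in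
    0 < k -> 1 < d -> (forall x, 0 < w x) ->
    (forall x y, edge x y -> D x = (D y).+1 \/ D y = (D x).+1) ->
    (forall x y : G, walk_le d x y) -> far d a b ->
  exists H : sgraph, stepwise_irregular k H /\ has_diameter H d.
Proof.
move=> D k_gt0 d_gt1 w_gt0 Dstep reach fab.
exists (blowup (fun x => k * w x)); split; last first.
  by apply: has_diameter_blowup fab => // x; rewrite muln_gt0 k_gt0 w_gt0.
move=> u v uv; rewrite !deg_blowup -!big_distrr /=.
rewrite -/(D (tag u)) -/(D (tag v)).
by case: (Dstep _ _ uv) => ->; rewrite mulnS; lia.
Qed.

(** * Paths and their vertex weights *)

Section PathGraph.
Variable d : nat.

Definition path_edge : rel 'I_d.+1 := fun i j => (i.+1 == j) || (j.+1 == i).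

Lemma path_edge_sym : symmetric path_edge.
Proof. by move=> i j; exact: orbC. Qed.

Lemma path_edge_irrefl : irreflexive path_edge.
Proof. by move=> i; rewrite /path_edge; lia. Qed.

Definition path_graph := SGraph path_edge_sym path_edge_irrefl.

Lemma path_graph_reach (i j : path_graph) : walk_le d i j.
Proof.
(* Together the inequalities say |i - j| <= n, free of truncated subtraction. *)
suff near n : i <= j + n -> j <= i + n -> walk_le n i j.
  by apply: near; have := ltn_ord i; have := ltn_ord j; lia.
elim: n i => [|n IHn] i ij ji.
  have -> : i = j by apply: ord_inj; lia.
  exact: walk_le_refl.
have [lt_ij|lt_ji|/ord_inj->] := ltngtP i j; last exact: walk_le_refl.
- have lt_i1 : i.+1 < d.+1 by have := ltn_ord j; lia.
  apply: (@walk_le_step path_graph _ _ (Ordinal lt_i1)).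
    by rewrite /= /path_edge /= eqxx.
  by apply: IHn => /=; lia.
- have lt_i1 : i.-1 < d.+1 by have := ltn_ord i; lia.
  apply: (@walk_le_step path_graph _ _ (Ordinal lt_i1)).
    by rewrite /= /path_edge /=; lia.
  by apply: IHn => /=; lia.
Qed.

Lemma path_graph_far : far d (ord0 : path_graph) (ord_max : path_graph).
Proof.
have bound (p : seq path_graph) (i : path_graph) :
    path (@edge path_graph) i p -> (last i p : nat) <= i + size p.
  elim: p i => [|j p IHp] i /=; first by rewrite addn0.
  case/andP=> ij /IHp /leq_trans-> //.
  by rewrite addnS -addSn leq_add2r; case/orP: ij => /eqP <- //; exact: leqW.
by move=> p /bound + pd; rewrite pd add0n.
Qed.

(** The boolean factors remove the neighbour missing at an end, in particular the junk value
    [0.-1 = 0]. *)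
Lemma sum_path_edge (w : nat -> nat) (i : path_graph) :
  \sum_(j | edge i j) w j = (0 < i) * w i.-1 + (i < d) * w i.+1.
Proof.
have single (m : nat) :
    \sum_(j < d.+1) (if m == j then w j else 0) = (m < d.+1) * w m.
  have [lt_m|le_m] := ltnP m d.+1.
    rewrite -big_mkcond (big_pred1 (Ordinal lt_m)) => [|j]; first by rewrite mul1n.
    exact: (eq_sym m).
  by rewrite big1 // => j _; have := ltn_ord j; case: eqP => //; lia.
have lt_i := ltn_ord i.
have -> : (0 < i) * w i.-1 = \sum_(j < d.+1) (if j.+1 == i then w j else 0).
  case: (posnP i) => [->|i_gt0]; first by rewrite big1.
  transitivity (\sum_(j < d.+1) (if i.-1 == j then w j else 0)).
    by rewrite single (leq_ltn_trans (leq_pred i)).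
  by apply: eq_bigr => j _; rewrite -{2}(prednK i_gt0) eqSS eq_sym.
rewrite -ltnS -single -big_split big_mkcond /=; apply: eq_bigr => j _.
rewrite /path_edge; case: (i.+1 =P j) => [<-|_] /=; last by rewrite addn0.
by rewrite gtn_eqF.
Qed.

End PathGraph.

(** Even positions alternate 1, 2, so odd ones see 3; odd positions all weigh 2, so even ones see 4,
    or 2 at the ends. *)
Definition even_weight i := if i %% 4 == 0 then 1 else 2.

(** Even positions all weigh 2, so odd ones see 4, or 2 at the end [d]. Odd positions weigh 3 2 1 2
    1 ..., so even ones see 3 5 3 3 ...; position [d - 1] must see 3, hence [d >= 5]. *)
Definition odd_weight i :=
  if i == 1 then 3 else if i %% 4 == 1 then 1 else 2.

(** * The exceptional diameter 3 *)

Section Crown.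

(* Vertices 0, 1, 2 and 3, 4, 5 form the 6-cycle ([i] and [i + 3] are the
   non-adjacent pairs), and 6 is the extra vertex. *)
Definition crown_adj (i j : nat) : bool :=
  [&& i < 3, 3 <= j & j != i + 3] || [&& j < 3, 3 <= i & i != j + 3].

Definition crown_edge : rel 'I_7 := fun i j => crown_adj i j.

Lemma crown_edge_sym : symmetric crown_edge.
Proof. by move=> i j; exact: orbC. Qed.

Lemma crown_edge_irrefl : irreflexive crown_edge.
Proof. by move=> i; rewrite /crown_edge /crown_adj; lia. Qed.

Definition crown := SGraph crown_edge_sym crown_edge_irrefl.

(** The vertices 0, 1, 2 see 1 + 1 + 3, the vertices 3, 4, 5 see 2 + 2, and 6 sees 2 + 2 + 2. *)
Definition crown_weight i := if i < 3 then 2 else if i < 6 then 1 else 3.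

Lemma sum_crown_edge (i : crown) :
  \sum_(j : crown | edge i j) crown_weight j =
  if i < 3 then 5 else if i < 6 then 4 else 6.
Proof.
rewrite big_mkcond !big_ord_recl big_ord0.
by case: i; do 7?[case=> //].
Qed.

Lemma crown_reach (i j : crown) : walk_le 3 i j.
Proof.
have step n (x y z : crown) :
    (x == y) || edge x y -> walk_le n y z -> walk_le n.+1 x z.
  by case/predU1P=> [->|]; [exact: walk_leW | exact: walk_le_step].
(* Allowing each of the three steps to stay put covers all lengths up to 3 in one finite check. *)
have [x [y /and3P[ix xy yj]]] : exists x y : crown,
    [&& (i == x) || edge i x, (x == y) || edge x y & (y == j) || edge y j].
  case: i j => [i lt_i] [j lt_j].
  have /allP/(_ i) : all (fun i => all (fun j => has (fun x => has (fun y =>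
      [&& (i == x) || crown_adj i x, (x == y) || crown_adj x y
        & (y == j) || crown_adj y j]) (iota 0 7)) (iota 0 7)) (iota 0 7)) (iota 0 7).
    by vm_compute.
  rewrite mem_iota => /(_ lt_i)/allP/(_ j); rewrite mem_iota => /(_ lt_j).
  case/hasP=> x; rewrite mem_iota => lt_x /hasP[y]; rewrite mem_iota => lt_y.
  by exists (Ordinal lt_x), (Ordinal lt_y).
exact: step ix (step _ _ _ _ xy (step _ _ _ _ yj (walk_le_refl 0 j))).
Qed.

(** 0 and 3 are a removed matching pair, hence not adjacent, and lie in opposite colour classes,
    hence have no common neighbour. *)
Lemma crown_far :
  far 3 (Ordinal (isT : 0 < 7) : crown) (Ordinal (isT : 3 < 7) : crown).
Proof.
move=> [|x [|y [|z p]]] //=.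
- by move=> + x3; rewrite x3.
- by move=> + y3; rewrite y3 andbT /crown_edge /crown_adj /=; case: x => x /= _; lia.
Qed.

End Crown.

Theorem theorem3p3 (k d : nat) (hk : 1 <= k) (hd : 2 <= d) :
  exists G : sgraph, stepwise_irregular k G /\ has_diameter G d.
Proof.
have path_case (w : nat -> nat) :
    (forall i, 0 < w i) ->
    let D i := (0 < i) * w i.-1 + (i < d) * w i.+1 in
    (forall i, i < d -> D i = (D i.+1).+1 \/ D i.+1 = (D i).+1) ->
    exists G : sgraph, stepwise_irregular k G /\ has_diameter G d.
  move=> w_gt0 D Dstep.
  apply: (@weighted_si_diameter (path_graph d) (fun i => w i) _ _ _ _ hk hd _ _
            (@path_graph_reach d) (@path_graph_far d)) => // i j ij.
  rewrite !sum_path_edge -/(D i) -/(D j).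
  case/orP: ij => /eqP ij; rewrite -ij.
    by apply: Dstep; rewrite -ltnS ij.
  by apply/or_comm/Dstep; rewrite -ltnS ij.
have [odd_d|even_d] := boolP (odd d); last first.
  apply: (path_case even_weight) => [i|i lt_i]; rewrite /even_weight.
    by case: ifP.
  have d_mod2 : d %% 2 = 0 by rewrite modn2 (negbTE even_d).
  by case: i lt_i => [|i] lt_i /=; do ?case: ifP; lia.
have [d3|d_neq3] := eqVneq d 3.
  rewrite d3; apply: (@weighted_si_diameter crown (fun i => crown_weight i) _ _ _ _ hk _ _ _
            crown_reach crown_far) => // [i|i j].
    by rewrite /crown_weight; do 2?case: ifP.
  rewrite !sum_crown_edge /= /crown_edge /crown_adj.
  by do 4?case: ifP; lia.
apply: (path_case odd_weight) => [i|i lt_i]; rewrite /odd_weight.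
  by do 2?case: ifP.
(* The parity is restated as a remainder so that [lia] can combine it with the residues mod 4. *)
have d_mod2 : d %% 2 = 1 by rewrite modn2 odd_d.
by case: i lt_i => [|i] lt_i /=; do ?case: ifP; lia.
Qed.
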